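(* Let $t\in\mathbb R\setminus\{0\}$ and let $f(q_t)=\sum_{k=0}^\infty q_t^kf_k$ be a power series with coefficients $f_k\in\mathbb H_t^{n\times m}$, converging in a neighborhood of the origin. Then the following are equivalent: (1) There exist $N\in\mathbb N_0$ and matrices $(A,B,C)\in\mathbb H_t^{N\times N}\times\mathbb H_t^{N\times m}\times\mathbb H_t^{n\times N}$ such that, with $D=f(0)$, $$f(q_t)=D+q_t\star C\star(I_N-q_t\star A)^{-\star}\star B.$$ (2) There exist $N\in\mathbb N_0$ and $(A,B,C)\in\mathbb H_t^{N\times N}\times\mathbb H_t^{N\times m}\times\mathbb H_t^{n\times N}$ such that $f_k=CA^{k-1}B$ for $k=1,2,\dots$. (3) The real linear span $\mathfrak M(f)$ of the functions $R_0^kfb$, where $k=0,1,\dots$ and $b$ runs through $\mathbb H_t^{m\times1}$, is a finite dimensional real vector space. (4) $f$ is the $\star$-quotient of two matrix-valued polynomials, $f=P_1\star P_2^{-\star}=P_3^{-\star}\star P_4$, such that the denominator polynomials $P_2$ and $P_3$ are invertible at the origin. (5) The restriction of $f$ to the real line is a rational function with no pole at the origin, with coefficients matrices with entries in $\mathbb H_t$.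
   Context: For $t\in\mathbb R\setminus\{0\}$, $\mathbb H_t$ is the real algebra (matrix addition and multiplication) of matrices $q_t=\begin{pmatrix}a&tb\\ \overline b&\overline a\end{pmatrix}$, $a,b\in\mathbb C$, with unit $1=I_2$; $\mathbb H_t^{n\times m}$ denotes $n\times m$ matrices with entries in $\mathbb H_t$, and $I_N$ the identity of $\mathbb H_t^{N\times N}$. The variable $q_t\in\mathbb H_t$ multiplies a matrix entrywise from the left. For power series with matrix coefficients of compatible sizes, the $\star$-product is $\left(\sum q_t^n\alpha_n\right)\star\left(\sum q_t^n\beta_n\right)=\sum_nq_t^n\sum_{k=0}^n\alpha_{n-k}\beta_k$; $S^{-\star}$ is the inverse of a square $S$ with respect to $\star$ (it exists near the origin when $S(0)$ is invertible). A matrix-valued polynomial is a finite sum $\sum_k q_t^kP_k$ with $P_k$ matrices over $\mathbb H_t$ (in (4), $P_1,P_4$ are of size $n\times m$, $P_2$ of size $m\times m$ and $P_3$ of size $n\times n$). The backward shift is $R_0\left(\sum_{k=0}^\infty q_t^kf_k\right)=\sum_{k=1}^\infty q_t^{k-1}f_k$, and $R_0^kfb$ is the power series obtained from $R_0^kf$ by multiplying all coefficients by $b$ on the right. In (5), restriction to the real line means setting $q_t=xI_2$, $x\in\mathbb R$; a rational function of the real variable $x$ without pole at the origin, with coefficients in $\mathbb H_t$, is a function belonging to the smallest family of matrix-valued functions (with entries in $\mathbb H_t$, of all sizes) real analytic in a neighborhood of the origin that contains the constants and the variable $x$ and is closed under sums and products of compatible sizes and under inversion of square functions invertible at the origin.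 *)

(* Defs.v *)
From HB Require Import structures.
From mathcomp Require Import all_boot all_order all_algebra.
From mathcomp Require Import complex.
From mathcomp Require Import all_classical all_reals all_analysis.

Set Implicit Arguments.
Unset Strict Implicit.
Unset Printing Implicit Defensive.

Import Order.TTheory GRing.Theory Num.Theory.
Import numFieldNormedType.Exports.

Local Open Scope classical_set_scope.
Local Open Scope ring_scope.
Local Open Scope complex_scope.

(** [squat t] is the real algebra H_t: a subring of the 2 x 2 complex matrices,
    an algebra over [R], so that [x%:A] is the matrix [x I_2] for [x : R]. *)
Section ScaledQuaternions.
Variables (R : realType) (t : R).

Definition sqmx (a b : R[i]) : 'M[R[i]]_2 :=
  \matrix_(i < 2, j < 2)
    if i == 0 then (if j == 0 then a else t%:C * b)
    else (if j == 0 then conjc b else conjc a).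

Definition is_squat : {pred 'M[R[i]]_2} :=
  fun M => `[< exists a b : R[i], M = sqmx a b >].

Lemma squatP (M : 'M[R[i]]_2) :
  reflect (exists a b, M = sqmx a b) (M \in is_squat).
Proof. exact: asboolP. Qed.

Lemma conjc_real (x : R) : conjc x%:C = x%:C.
Proof. by rewrite /= oppr0. Qed.

Lemma squat_subring : subring_closed is_squat.
Proof.
split.
- apply/squatP; exists 1, 0; apply/matrixP => i j; rewrite !mxE.
  by case: i => [[|[|//]] ?]; case: j => [[|[|//]] ?] /=;
    rewrite ?mulr0 ?oppr0.
- move=> _ _ /squatP[a [b ->]] /squatP[c [d ->]].
  apply/squatP; exists (a - c), (b - d); apply/matrixP => i j; rewrite !mxE.
  by case: (i == 0); case: (j == 0); rewrite ?mulrBr ?rmorphB.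
- move=> _ _ /squatP[a [b ->]] /squatP[c [d ->]].
  apply/squatP; exists (a * c + t%:C * b * conjc d), (a * d + b * conjc c).
  apply/matrixP => i j; rewrite !mxE !big_ord_recl big_ord0 !mxE addr0 /=.
  case: (i == 0); case: (j == 0) => //.
  + by rewrite mulrDr !mulrA [a * _]mulrC.
  + by rewrite rmorphD !rmorphM /= conjcK addrC.
  + rewrite rmorphD !rmorphM /= conjcK oppr0 addrC; congr (_ + _).
    by rewrite mulrCA mulrA.
Qed.

HB.instance Definition _ :=
  GRing.isSubringClosed.Build 'M[R[i]]_2 is_squat squat_subring.

Record squat := SQuat { squat_mx :> 'M[R[i]]_2; _ : squat_mx \in is_squat }.

HB.instance Definition _ := [isSub for squat_mx].
HB.instance Definition _ := [Choice of squat by <:].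
HB.instance Definition _ := [SubChoice_isSubNzRing of squat by <:].

Lemma squat_scale_subproof (x : R) (q : squat) :
  x%:C *: squat_mx q \in is_squat.
Proof.
case: q => _ /= /squatP[a [b ->]].
apply/squatP; exists (x%:C * a), (x%:C * b); apply/matrixP => i j.
rewrite !mxE; case: (i == 0); case: (j == 0) => //.
- by rewrite mulrCA.
- by rewrite rmorphM /= oppr0.
- by rewrite rmorphM /= oppr0.
Qed.

Definition squat_scale (x : R) (q : squat) : squat :=
  SQuat (squat_scale_subproof x q).

Lemma squat_scaleA x y q :
  squat_scale x (squat_scale y q) = squat_scale (x * y) q.
Proof. by apply/val_inj; rewrite /= rmorphM scalerA. Qed.

Lemma squat_scale1 : left_id 1 squat_scale.
Proof. by move=> q; apply/val_inj; rewrite /= rmorph1 scale1r. Qed.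

Lemma squat_scaleDr : right_distributive squat_scale +%R.
Proof. by move=> x p q; apply/val_inj; rewrite /= scalerDr. Qed.

Lemma squat_scaleDl q : {morph squat_scale^~ q : x y / x + y}.
Proof. by move=> x y; apply/val_inj; rewrite /= rmorphD scalerDl. Qed.

HB.instance Definition _ := GRing.Zmodule_isLmodule.Build R squat
  squat_scaleA squat_scale1 squat_scaleDr squat_scaleDl.

Lemma squat_scaleAl (x : R) (p q : squat) : x *: (p * q) = x *: p * q.
Proof. by apply/val_inj; rewrite /= -scalerAl. Qed.

HB.instance Definition _ := GRing.Lmodule_isLalgebra.Build R squat squat_scaleAl.

Lemma squat_scaleAr (x : R) (p q : squat) : x *: (p * q) = p * (x *: q).
Proof. by apply/val_inj; rewrite /= -scalerAr. Qed.

HB.instance Definition _ :=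
  GRing.Lalgebra_isAlgebra.Build R squat squat_scaleAr.

(** The topology induced by that of the 2 x 2 complex matrices. *)
HB.instance Definition _ := Topological.copy squat
  (initial_topology (squat_mx : squat -> 'M[R[i]^o]_2)).
HB.instance Definition _ := isPointed.Build squat 0.

End ScaledQuaternions.

(** A power series [\sum_k q^k f_k] is the sequence of its coefficients, which
    multiply the powers of the variable from the right; equality of power series
    is equality of coefficients. *)
Notation qseries t n m := (nat -> 'M[squat t]_(n, m)) (only parsing).

Reserved Notation "f ⋆ g" (at level 40, left associativity).

Section PowerSeries.
Variables (R : realType) (t : R).

Definition mx_invertible n (M : 'M[squat t]_n) : Prop :=
  exists N : 'M[squat t]_n, M *m N = 1%:M /\ N *m M = 1%:M.

Definition ps_monomial n m (k : nat) (M : 'M[squat t]_(n, m)) : qseries t n m :=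
  fun j => if j == k then M else 0.

Definition ps_const n m (M : 'M[squat t]_(n, m)) : qseries t n m :=
  ps_monomial 0 M.

(** The variable [q] acts entrywise from the left, that is, as [q I_n]. *)
Definition ps_var n : qseries t n n := ps_monomial 1 1%:M.

Definition star n p m (f : qseries t n p) (g : qseries t p m) : qseries t n m :=
  fun k => \sum_(j < k.+1) f (k - j)%N *m g j.

Local Notation "f ⋆ g" := (star f g).

(** The ⋆-inverse is unique if it exists, which is the case when the constant
    coefficient is invertible; otherwise the value [0] is a dummy. *)
Definition star_inv n (S : qseries t n n) : qseries t n n :=
  xget 0 [set T | S ⋆ T = ps_const 1%:M /\ T ⋆ S = ps_const 1%:M].

Definition ps_polynomial n m (P : qseries t n m) : Prop :=
  \forall k \near \oo, P k = 0.

Definition backward_shift n m (f : qseries t n m) : qseries t n m :=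
  fun k => f k.+1.

Definition ps_mulr n m p (f : qseries t n m) (b : 'M[squat t]_(m, p)) :
  qseries t n p := fun k => f k *m b.

Definition ps_partial_sums n m (f : qseries t n m) (q : squat t) :
  nat -> 'M[squat t]_(n, m) := series (fun k => q ^+ k *: f k).

Definition ps_converges_near0 n m (f : qseries t n m) : Prop :=
  \forall q \near (0 : squat t), cvgn (ps_partial_sums f q).

End PowerSeries.

Notation "f ⋆ g" := (star f g).

Section RealSpan.
Variables (R : realType) (t : R) (V : lmodType (squat t)).

Definition real_span (S : set V) : set V :=
  [set v | exists (d : nat) (c : 'I_d -> R) (e : 'I_d -> V),
    (forall i, S (e i)) /\ v = \sum_(i < d) (c i)%:A *: e i].

Definition real_finite_dim (W : set V) : Prop :=
  exists (d : nat) (e : 'I_d -> V),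
    (forall i, W (e i)) /\ W `<=` real_span (range e).

End RealSpan.

Definition shift_space (R : realType) (t : R) n m (f : qseries t n m) :
    set (nat -> 'cV[squat t]_n) :=
  real_span [set g | exists (k : nat) (b : 'cV[squat t]_m),
    g = ps_mulr (iter k (@backward_shift R t n m) f) b].

Section RationalFunctions.
Variables (R : realType) (t : R).

Definition real_analytic_near0 n m (r : R -> 'M[squat t]_(n, m)) : Prop :=
  \forall x \near (0 : R), exists a : qseries t n m,
    \forall h \near (0 : R), ps_partial_sums a h%:A @ \oo --> r (x + h).

(** The functions matter only as germs at the origin. Analyticity has to be
    required only of inverses: it is inherited by sums and products. *)
Inductive rational_near0 :
    forall n m : nat, (R -> 'M[squat t]_(n, m)) -> Prop :=
| rational_const n m (M : 'M[squat t]_(n, m)) : rational_near0 (fun _ => M)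
| rational_var :
    rational_near0 (fun x : R => (x%:A)%:M : 'M[squat t]_1)
| rational_add n m (r s : R -> 'M[squat t]_(n, m)) :
    rational_near0 r -> rational_near0 s -> rational_near0 (fun x => r x + s x)
| rational_mul n p m (r : R -> 'M[squat t]_(n, p)) (s : R -> 'M[squat t]_(p, m)) :
    rational_near0 r -> rational_near0 s -> rational_near0 (fun x => r x *m s x)
| rational_inv n (r s : R -> 'M[squat t]_n) :
    rational_near0 r -> mx_invertible (r 0) -> real_analytic_near0 s ->
    (\forall x \near (0 : R), r x *m s x = 1%:M /\ s x *m r x = 1%:M) ->
    rational_near0 s.

End RationalFunctions.

(* Main.v *)
Require Import Defs.
From mathcomp Require Import all_boot all_order all_algebra.
From mathcomp Require Import complex.
From mathcomp Require Import all_classical all_reals all_analysis.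
From mathcomp Require Import zify ring lra.

Set Implicit Arguments.
Unset Strict Implicit.
Unset Printing Implicit Defensive.

Import Order.TTheory GRing.Theory Num.Theory.
Import numFieldNormedType.Exports.

Local Open Scope classical_set_scope.
Local Open Scope ring_scope.

(** Every condition is equivalent to the existence of a real polynomial [p] with
    [p(0) = 1] such that [p ⋆ f] is a polynomial.  Real coefficients are central,
    so [p] serves as a left and as a right denominator.  A linear map that
    preserves the real span of a finite family is annihilated by a monic real
    polynomial (Cayley-Hamilton); applied to multiplication by [A], and to the
    backward shift on the space of (3), this produces [p].  Conversely, the
    recurrence expressed by [p ⋆ f = Q] is realized by a block companion matrix.
    A rational function [r] satisfies [p(x) r(x) = Q(x)] near [0]: this is
    preserved by inversion because the formal inverse of [Q] obeys a recurrence,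
    hence is realizable and has itself a real denominator.  The identity theorem
    for real power series then gives [p ⋆ f = Q].  *)

(** * The ⋆-product *)

Section StarProduct.
Variables (R : realType) (t : R).
Local Notation H := (squat t).

Lemma starE n p m (f : qseries t n p) (g : qseries t p m) k :
  (f ⋆ g) k = \sum_(j < k.+1) f (k - j)%N *m g j.
Proof. by []. Qed.

Lemma star_rev n p m (f : qseries t n p) (g : qseries t p m) k :
  (f ⋆ g) k = \sum_(j < k.+1) f j *m g (k - j)%N.
Proof.
rewrite starE (reindex_inj rev_ord_inj) /=; apply: eq_bigr => j _.
by rewrite subSS subKn // -ltnS.
Qed.

Lemma starA n p q m (f : qseries t n p) (g : qseries t p q)
    (h : qseries t q m) :
  f ⋆ (g ⋆ h) = f ⋆ g ⋆ h.
Proof.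
apply/funext => i; rewrite star_rev [RHS]star_rev.
(* Both sides sum [f j], [g l], [h k] over [j + l + k = i]. The term [coef3] eliminates [l], and the
   double sum over the triangle [j + k <= i] is then exchanged. *)
pose coef3 j k := f j *m (g (i - j - k)%N *m h k).
transitivity (\sum_(j < i.+1) \sum_(k < i.+1 | (k <= i - j)%N) coef3 j k).
  apply: eq_bigr => j _.
  rewrite starE mulmx_sumr (big_ord_narrow_leq (leq_subr _ _)).
  by apply: eq_bigr => k _.
rewrite (exchange_big_dep predT) //=.
rewrite (reindex_inj rev_ord_inj) /=; apply: eq_bigr => k _.
transitivity (\sum_(j < i.+1 | (j <= k)%N) coef3 j (i - k)%N).
  apply: eq_big => [j|j _]; last by rewrite subSS.
  by have := ltn_ord j; have := ltn_ord k; lia.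
rewrite star_rev mulmx_suml (big_ord_narrow_leq (ltn_ord k : (k <= i)%N)).
apply: eq_bigr => j _ /=; rewrite /coef3 mulmxA.
by rewrite subnAC subKn // -ltnS.
Qed.

Lemma qseries_addE n m (f g : qseries t n m) k : (f + g) k = f k + g k.
Proof. by []. Qed.

Lemma qseries_oppE n m (f : qseries t n m) k : (- f) k = - f k.
Proof. by []. Qed.

Lemma starDl n p m (f1 f2 : qseries t n p) (g : qseries t p m) :
  (f1 + f2) ⋆ g = f1 ⋆ g + f2 ⋆ g.
Proof.
apply/funext => k; rewrite [RHS]qseries_addE !starE -big_split /=.
by apply: eq_bigr => j _; rewrite qseries_addE mulmxDl.
Qed.

Lemma starDr n p m (f : qseries t n p) (g1 g2 : qseries t p m) :
  f ⋆ (g1 + g2) = f ⋆ g1 + f ⋆ g2.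
Proof.
apply/funext => k; rewrite [RHS]qseries_addE !starE -big_split /=.
by apply: eq_bigr => j _; rewrite qseries_addE mulmxDr.
Qed.

Lemma starNl n p m (f : qseries t n p) (g : qseries t p m) :
  (- f) ⋆ g = - (f ⋆ g).
Proof.
apply/funext => k; rewrite [RHS]qseries_oppE !starE -sumrN.
by apply: eq_bigr => j _; rewrite qseries_oppE mulNmx.
Qed.

Lemma starNr n p m (f : qseries t n p) (g : qseries t p m) :
  f ⋆ (- g) = - (f ⋆ g).
Proof.
apply/funext => k; rewrite [RHS]qseries_oppE !starE -sumrN.
by apply: eq_bigr => j _; rewrite qseries_oppE mulmxN.
Qed.

Lemma ps_const_star n p m (M : 'M[H]_(n, p)) (g : qseries t p m) k :
  (ps_const M ⋆ g) k = M *m g k.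
Proof.
rewrite star_rev big_ord_recl big1 ?addr0 ?subn0 // => j _.
by rewrite /ps_const /ps_monomial /= mul0mx.
Qed.

Lemma star_ps_const n p m (f : qseries t n p) (M : 'M[H]_(p, m)) k :
  (f ⋆ ps_const M) k = f k *m M.
Proof.
rewrite starE big_ord_recl big1 ?addr0 ?subn0 // => j _.
by rewrite /ps_const /ps_monomial /= mulmx0.
Qed.

Lemma star1l n m (f : qseries t n m) : ps_const 1%:M ⋆ f = f.
Proof. by apply/funext => k; rewrite ps_const_star mul1mx. Qed.

Lemma star1r n m (f : qseries t n m) : f ⋆ ps_const 1%:M = f.
Proof. by apply/funext => k; rewrite star_ps_const mulmx1. Qed.

Lemma ps_var_star n m (f : qseries t n m) k :
  (ps_var t n ⋆ f) k = if k is j.+1 then f j else 0.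
Proof.
rewrite star_rev; case: k => [|k]; rewrite big_ord_recl mul0mx add0r.
  by rewrite big_ord0.
rewrite big_ord_recl mul1mx big1 ?addr0 /= ?subSS ?subn0 // => j _.
by rewrite mul0mx.
Qed.

Lemma star_ps_var n m (f : qseries t n m) : f ⋆ ps_var t m = ps_var t n ⋆ f.
Proof.
apply/funext => k; rewrite ps_var_star starE; case: k => [|k].
  by rewrite big_ord_recl big_ord0 mulmx0 addr0.
rewrite 2!big_ord_recl mulmx0 add0r mulmx1 big1 ?addr0 ?subSS ?subn0 // => j _.
by rewrite mulmx0.
Qed.

Lemma star_inverse_unique n (S T T' : qseries t n n) :
  T ⋆ S = ps_const 1%:M -> S ⋆ T' = ps_const 1%:M -> T = T'.
Proof. by move=> TS ST'; rewrite -[T]star1r -ST' starA TS star1l. Qed.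

Lemma star_invE n (S T : qseries t n n) :
  S ⋆ T = ps_const 1%:M -> T ⋆ S = ps_const 1%:M -> star_inv S = T.
Proof.
move=> ST TS; rewrite /star_inv; case: xgetP => [T' _ [ST' _]|/(_ T)[]//].
by exact/esym/(star_inverse_unique TS).
Qed.

(** Solving coefficient [k] of the equation for the term [S 0%N *m T k] gives a recursion for [T k]
    over the earlier coefficients, with [V] as the inverse of [S 0%N]. *)
Lemma star_right_inverse_ex n (S : qseries t n n) (V : 'M[H]_n) :
  S 0%N *m V = 1%:M -> exists T, S ⋆ T = ps_const 1%:M /\ T 0%N = V.
Proof.
move=> SV.
pose step (T : qseries t n n) : qseries t n n :=
  fun k => V *m (ps_const 1%:M k - \sum_(j < k) S (k - j)%N *m T j).
(* The course-of-values recursion is run by iterating [step] from the zero series: coefficient [k]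
   is stable after [k.+1] iterations. *)
have stab (k N N' : nat) : (k < N)%N -> (k < N')%N ->
    iter N step 0 k = iter N' step 0 k.
  elim/ltn_ind: k N N' => k IH [//|N] [//|N'] kN kN' /=.
  rewrite /step; congr (_ *m (_ - _)); apply: eq_bigr => j _.
  by congr (_ *m _); apply: IH => //; apply: leq_trans (ltn_ord j) _.
pose T k := iter k.+1 step 0 k.
have TE k : T k = V *m (ps_const 1%:M k - \sum_(j < k) S (k - j)%N *m T j).
  rewrite {1}/T iterS {1}/step; congr (_ *m (_ - _)); apply: eq_bigr => j _.
  by congr (_ *m _); exact: stab.
exists T; split; last by rewrite TE big_ord0 subr0 mulmx1.
apply/funext => k; rewrite starE big_ord_recr /= subnn [T k]TE mulmxA SV mul1mx.
by rewrite addrC subrK.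
Qed.

(** The right inverse [T] of [S] has constant coefficient [V], which [S 0%N] inverts, so [T] has a
    right inverse as well; by associativity that one is [S]. *)
Lemma star_inverse_ex n (S : qseries t n n) : mx_invertible (S 0%N) ->
  exists T, S ⋆ T = ps_const 1%:M /\ T ⋆ S = ps_const 1%:M.
Proof.
move=> [V [SV VS]]; have [T [ST T0]] := star_right_inverse_ex SV.
have [|S' [TS' _]] := @star_right_inverse_ex _ T (S 0%N); first by rewrite T0.
by exists T; split=> //; rewrite {1}(star_inverse_unique ST TS').
Qed.

(** With [G] the geometric series of [A], both ⋆-products of [q A] and [G] equal [G - 1], so [G]
    inverts [1 - q A] on either side. *)
Lemma star_inv_geometric N (A : 'M[H]_N) :
  star_inv (ps_const 1%:M - ps_var t N ⋆ ps_const A) = fun k => A ^+ k.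
Proof.
have [geoA Ageo] : ps_var t N ⋆ ps_const A ⋆ (fun k => A ^+ k) =
    (fun k => A ^+ k) - ps_const 1%:M /\
    (fun k => A ^+ k) ⋆ (ps_var t N ⋆ ps_const A) =
    (fun k => A ^+ k) - ps_const 1%:M.
  split; apply/funext => k.
    rewrite -starA ps_var_star qseries_addE.
    case: k => [|k]; first by rewrite subrr.
    by rewrite ps_const_star subr0 exprS.
  rewrite starA star_ps_var -starA ps_var_star qseries_addE.
  case: k => [|k]; first by rewrite subrr.
  by rewrite star_ps_const subr0 exprSr.
apply: star_invE; rewrite ?starDl ?starDr ?starNl ?starNr ?geoA ?Ageo;
  by rewrite ?star1l ?star1r opprB addrC subrK.
Qed.

End StarProduct.

(** * Annihilating polynomials on finitely spanned real spaces *)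

Section RealSpanTheory.
Variables (R : realType) (t : R) (V : lmodType (squat t)).
Implicit Types (S : set V) (u v : V).

Lemma real_scaleA (a b : R) v : a%:A *: (b%:A *: v) = (a * b)%:A *: v.
Proof. by rewrite scalerA mulr_algl scalerA. Qed.

Lemma real_span_gen S v : S v -> real_span S v.
Proof.
move=> Sv; exists 1%N, (fun _ => 1), (fun _ => v); split=> //.
by rewrite big_ord1 !scale1r.
Qed.

Lemma real_span0 S : real_span S 0.
Proof.
exists 0%N, (fun _ => 0), (fun _ => 0); split; first by case.
by rewrite big_ord0.
Qed.

Lemma real_spanD S u v : real_span S u -> real_span S v -> real_span S (u + v).
Proof.
move=> [d1 [c1 [e1 [S1 ->]]]] [d2 [c2 [e2 [S2 ->]]]].
exists (d1 + d2)%N,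
  (fun i => match fintype.split i with inl j => c1 j | inr j => c2 j end),
  (fun i => match fintype.split i with inl j => e1 j | inr j => e2 j end).
split; first by move=> i; case: (fintype.split i).
rewrite big_split_ord /=; congr (_ + _); apply: eq_bigr => i _.
  by rewrite (unsplitK (inl i)).
by rewrite (unsplitK (inr i)).
Qed.

Lemma real_spanZ S (a : R) v : real_span S v -> real_span S (a%:A *: v).
Proof.
move=> [d [c [e [Se ->]]]]; exists d, (fun i => a * c i), e; split=> //.
by rewrite scaler_sumr; apply: eq_bigr => i _; rewrite real_scaleA.
Qed.

Lemma real_span_sum S (I : Type) (r : seq I) (F : I -> V) :
  (forall i, real_span S (F i)) -> real_span S (\sum_(i <- r) F i).
Proof.
move=> SF; elim/big_ind: _ => // [|u v]; [exact: real_span0|exact: real_spanD].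
Qed.

Lemma real_span_sub S S' :
  S `<=` real_span S' -> real_span S `<=` real_span S'.
Proof.
move=> SS' v [d [c [e [Se ->]]]]; apply: real_span_sum => i.
exact/real_spanZ/SS'.
Qed.

(** A combination may use a generator repeatedly; choosing an index for each of its terms lets the
    coefficients be collected index by index. *)
Lemma real_span_range d (e : 'I_d -> V) v : real_span (range e) v ->
  exists c : 'I_d -> R, v = \sum_(i < d) (c i)%:A *: e i.
Proof.
move=> [d' [c' [e' [e'e ->]]]].
have /choice[s se] (j : 'I_d') : exists i, e i = e' j.
  by have [i _ <-] := e'e j; exists i.
exists (fun i => \sum_(j | s j == i) c' j).
rewrite (partition_big s predT) //=; apply: eq_bigr => i _.
rewrite scaler_suml scaler_suml; apply: eq_bigr => j /eqP <-.
by rewrite se.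
Qed.

(* Cayley-Hamilton for the matrix of [phi] on a generating family, which need
   not be a basis. *)
Lemma real_linear_annihilator (phi : V -> V) d (e : 'I_d -> V) :
  (forall (a : R) u v, phi (a%:A *: u + v) = a%:A *: phi u + phi v) ->
  (forall i, real_span (range e) (phi (e i))) ->
  exists2 chi : {poly R}, chi \is monic &
    forall v, real_span (range e) v ->
      \sum_(k < size chi) (chi`_k)%:A *: iter k phi v = 0.
Proof.
move=> phiL phie.
have phiS I (r : seq I) (c : I -> R) (F : I -> V) :
    phi (\sum_(i <- r) (c i)%:A *: F i) = \sum_(i <- r) (c i)%:A *: phi (F i).
  elim: r => [|i r IH]; last by rewrite !big_cons phiL IH.
  (* Here [phi 0 = 0] follows from [phiL] with scalar [1] and both vectors zero. *)
  rewrite !big_nil; apply: (addrI (phi 0)).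
  rewrite addr0 -[X in X + _]scale1r -[X in X *: _]scale1r -phiL.
  by rewrite !scaler0 addr0.
have iter_sum k I (r : seq I) (c : I -> R) (F : I -> V) :
    iter k phi (\sum_(i <- r) (c i)%:A *: F i) =
    \sum_(i <- r) (c i)%:A *: iter k phi (F i).
  by elim: k => //= k ->; rewrite phiS.
have /choice[M Me] (i : 'I_d) := real_span_range (phie i).
suff [chi chi_monic chi0] : exists2 chi : {poly R}, chi \is monic &
    forall i, \sum_(k < size chi) (chi`_k)%:A *: iter k phi (e i) = 0.
  exists chi => // v /real_span_range[c ->].
  under eq_bigr do rewrite iter_sum scaler_sumr.
  rewrite exchange_big big1 //= => i _.
  under eq_bigr do rewrite real_scaleA mulrC -real_scaleA.
  by rewrite -scaler_sumr chi0 scaler0.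
case: d e phie M Me => [|d] e _ M Me; first by exists 1; [exact: monic1|case].
pose A := \matrix_(i, j) M i j.
exists (char_poly A) => [|i]; first exact: char_poly_monic.
(* Row [j] of [A ^+ k] is one possible coordinate vector of [iter k phi (e j)]. This suffices: a
   polynomial that kills [A] then kills every [e j]. *)
have iterE k j : iter k phi (e j) = \sum_l ((A ^+ k) j l)%:A *: e l.
  elim: k j => [|k IH] j.
    rewrite expr0 (bigD1 j) //= mxE eqxx !scale1r big1 ?addr0 // => l lj.
    by rewrite mxE eq_sym (negPf lj) mulr0n !scale0r.
  rewrite iterSr Me iter_sum.
  under eq_bigr do rewrite IH scaler_sumr.
  rewrite exchange_big; apply: eq_bigr => l _.
  rewrite exprS mxE scaler_suml scaler_suml; apply: eq_bigr => j' _.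
  by rewrite real_scaleA mxE.
under eq_bigr do rewrite iterE scaler_sumr.
rewrite exchange_big big1 //= => l _.
under eq_bigr do rewrite real_scaleA.
rewrite -!scaler_suml; have /matrixP/(_ i l) := Cayley_Hamilton A.
rewrite -[X in horner_mx _ X]coefK poly_def rmorph_sum summxE.
rewrite [X in _ = X]mxE => CH.
rewrite [X in X *: _](_ : _ = 0) ?scale0r //.
rewrite -[RHS](scale0r (1 : squat t)); congr (_ *: _); rewrite -[RHS]CH.
by apply: eq_bigr => k _; rewrite /= horner_mxZ rmorphXn /= horner_mx_X mxE.
Qed.

End RealSpanTheory.

(** * Real coordinates on H_t and finite real spanning families of matrices *)

Section SquatBasis.
Variables (R : realType) (t : R).
Local Notation H := (squat t).
Local Open Scope complex_scope.

Lemma sqmx_squat (a b : R[i]) : sqmx t a b \in is_squat t.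
Proof. by apply/squatP; exists a, b. Qed.

Definition mk_squat (a b : R[i]) : H := SQuat (sqmx_squat a b).

Lemma squat_mk (q : H) : exists a b, q = mk_squat a b.
Proof.
by case: q => M /[dup] /squatP[a [b Mab]] ?; exists a, b; apply/val_inj.
Qed.

(** The first column consists of [a] and the conjugate of [b], free of the factor [t], so its real
    and imaginary parts determine the element. *)
Definition squat_coord (q : H) : 'I_4 -> R :=
  fun i => [:: complex.Re (squat_mx q 0 0); complex.Im (squat_mx q 0 0);
                       complex.Re (squat_mx q 1 0);
                       complex.Im (squat_mx q 1 0)]`_i.

(* The last element is [mk_squat 0 (Complex 0 (-1))] because the lower left
   entry of [mk_squat a b] is the conjugate of [b]. *)
Definition squat_basis : 'I_4 -> H :=
  fun i => nth 0 [:: mk_squat 1 0; mk_squat (Complex 0 1) 0; mk_squat 0 1;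
                     mk_squat 0 (Complex 0 (-1))] i.

Lemma squat_basisE (q : H) :
  q = \sum_(i < 4) (squat_coord q i)%:A * squat_basis i.
Proof.
have [[a1 a2] [[b1 b2] ->]] := squat_mk q.
rewrite 4!big_ord_recr big_ord0 /= add0r /squat_coord /squat_basis /= !mulr_algl.
apply/val_inj/matrixP => i j; rewrite /= !mxE; apply/eqP.
by case: i => [[|[|//]] ?]; case: j => [[|[|//]] ?] /=;
  rewrite eq_complex /=; apply/andP; split; apply/eqP; ring.
Qed.

(** The elementary matrices multiplied by the elements of [squat_basis] form such a family. It makes
    [real_linear_annihilator] applicable to maps on matrices over H_t. *)
Lemma matrix_real_span n m : exists (d : nat) (e : 'I_d -> 'M[H]_(n, m)),
  forall M, real_span (range e) M.
Proof.
pose T : finType := ('I_n * 'I_m * 'I_4)%type.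
pose e (x : T) : 'M[H]_(n, m) := squat_basis x.2 *: delta_mx x.1.1 x.1.2.
exists #|{: T}|, (fun i => e (enum_val i)) => M.
rewrite [M]matrix_sum_delta; apply: real_span_sum => i; apply: real_span_sum => j.
rewrite {1}(squat_basisE (M i j)) scaler_suml; apply: real_span_sum => k.
rewrite -scalerA; apply/real_spanZ/real_span_gen.
by exists (enum_rank (i, j, k)) => //=; rewrite enum_rankK.
Qed.

End SquatBasis.

(** * Realizations and real denominators *)

Section Realization.
Variables (R : realType) (t : R).
Local Notation H := (squat t).

(* The state at time [k] stacks [f k, ..., f (k + L - 1)], and [A] is the block
   companion matrix. *)
Lemma recurrence_realization n m (f : qseries t n m) (L : nat)
    (c : 'I_L -> 'M[H]_n) :
  (forall k, f (k + L)%N = \sum_(i < L) c i *m f (k + i)%N) ->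
  exists (N : nat) (A : 'M[H]_N) (B : 'M[H]_(N, m)) (C : 'M[H]_(n, N)),
    forall k, f k = C *m A ^+ k *m B.
Proof.
(* State coordinates are pairs of a block in ['I_L] and a row in ['I_n], flattened by [enum_val]. *)
move=> frec; pose T : finType := ('I_L * 'I_n)%type.
pose ev : 'I_#|{: T}| -> T := fun i => enum_val i.
(* The last block row holds the recurrence coefficients; every other one copies the next block. *)
pose comp (a b : 'I_L) : 'M[H]_n :=
  if a.+1 == L then c b else if b == a.+1 :> nat then 1%:M else 0.
pose A : 'M[H]_#|{: T}| := \matrix_(i, j)
  comp (ev i).1 (ev j).1 (ev i).2 (ev j).2.
pose B : 'M[H]_(#|{: T}|, m) :=
  \matrix_(i, s) f (ev i).1 (ev i).2 s.
pose C : 'M[H]_(n, #|{: T}|) := \matrix_(r, j)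
  (((ev j).1 == 0 :> nat) && (r == (ev j).2))%:R.
exists #|{: T}|, A, B, C.
have sumT (F : T -> H) : \sum_j F (ev j) = \sum_a \sum_r F (a, r).
  rewrite -(big_enum_val F) pair_bigA; apply: eq_big => [x|[a r] _] //.
have compE k (a : 'I_L) : \sum_b comp a b *m f (k + b)%N = f (k + a).+1.
  rewrite /comp; case: eqVneq => [aL|aL]; first by rewrite -addnS aL frec.
  have aL' : (a.+1 < L)%N by rewrite ltn_neqAle aL ltn_ord.
  rewrite (bigD1 (Ordinal aL')) //= eqxx mul1mx big1 ?addr0 ?addnS // => b.
  by rewrite -val_eqE /= => /negPf ->; rewrite mul0mx.
have state k : A ^+ k *m B = \matrix_(i, s) 
      f (k + (ev i).1)%N (ev i).2 s.
  elim: k => [|k IH].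
    by rewrite expr0 mul1mx; apply/matrixP => i s; rewrite !mxE.
  rewrite exprS -mulmxA IH; apply/matrixP => i s; rewrite !mxE.
  under eq_bigr do rewrite !mxE.
  rewrite (sumT (fun x : T => comp (ev i).1 x.1 (ev i).2 x.2 *
    f (k + x.1)%N x.2 s)) /= addSn -compE summxE.
  by apply: eq_bigr => b _; rewrite mxE.
move=> k; rewrite -mulmxA state; apply/matrixP => r s; rewrite mxE.
under eq_bigr do rewrite !mxE.
rewrite (sumT (fun x : T =>
  ((x.1 == 0 :> nat) && (r == x.2))%:R * f (k + x.1)%N x.2 s)) /=.
(* For [L = 0] there is no state, and the recurrence, an empty sum, forces [f] to vanish. *)
case: L => [|L] in c frec T ev comp A B C sumT compE state *.
  by rewrite big_ord0; have := frec k; rewrite addn0 big_ord0 => ->; rewrite mxE.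
rewrite big_ord_recl /= [X in _ + X]big1 => [|a _]; last first.
  by rewrite big1 // => r' _; rewrite mul0r.
rewrite (bigD1 r) //= eqxx mul1r addn0 addr0 big1 ?addr0 // => r' r'r.
by rewrite eq_sym (negPf r'r) mul0r.
Qed.

Definition is_realizable n m (f : qseries t n m) : Prop :=
  exists (N : nat) (A : 'M[H]_N) (B : 'M[H]_(N, m)) (C : 'M[H]_(n, N)),
    forall k : nat, (1 <= k)%N -> f k = C *m A ^+ k.-1 *m B.

Lemma ps_polynomial_bound n m (P : qseries t n m) : ps_polynomial P ->
  exists L, forall k, (L <= k)%N -> P k = 0.
Proof. by case=> L _ PL; exists L => k; exact: PL. Qed.

(** Beyond the degrees of [P] and [P ⋆ f], the vanishing coefficients of [P ⋆ f], multiplied by [V],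
    express each coefficient of [f] by the [L] preceding ones. *)
Lemma left_quotient_realizable n m (P : qseries t n n) (f : qseries t n m) :
  ps_polynomial P -> mx_invertible (P 0%N) -> ps_polynomial (P ⋆ f) ->
  is_realizable f.
Proof.
move=> /ps_polynomial_bound[L1 PL] [V [_ VP]] /ps_polynomial_bound[L2 PfL].
pose L := maxn L1 L2.
(* The recurrence is stated for the shifted sequence because [is_realizable] leaves [f 0%N] free. *)
have [|N [A [B [C fE]]]] := @recurrence_realization n m (fun k => f k.+1) L
    (fun i => - (V *m P (L - i)%N)); last first.
  by exists N, A, B, C => -[//|k] _; rewrite fE.
move=> k; have : (P ⋆ f) (k.+1 + L)%N = 0 by rewrite PfL //; lia.
rewrite starE big_ord_recr /= subnn -addSn.
rewrite big_split_ord /= big1 ?add0r => [|j _]; last first.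
  by rewrite PL ?mul0mx //; have := ltn_ord j; lia.
move=> /(congr1 (mulmx V)); rewrite mulmxDr mulmx0 mulmxA VP mul1mx.
move=> /eqP; rewrite addrC addr_eq0 => /eqP ->.
rewrite mulmx_sumr -sumrN; apply: eq_bigr => i _.
by rewrite mulNmx mulmxA /= subnDl.
Qed.

Definition real_series n (p : {poly R}) : qseries t n n :=
  fun k => (p`_k)%:A%:M.

(** Real multiples of the unit are central in H_t, so such a scalar may pass from the right of a
    matrix to its left. *)
Lemma mulmx_real n m (M : 'M[H]_(n, m)) (a : R) : M *m a%:A%:M = a%:A *: M.
Proof.
apply/matrixP => i j; rewrite !mxE (bigD1 j) //= mxE eqxx mulr1n.
rewrite big1 ?addr0 ?mulr_algr ?mulr_algl // => k kj.
by rewrite mxE (negPf kj) mulr0n mulr0.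
Qed.

Lemma mulmx_real_scale n p m (M : 'M[H]_(n, p)) (a : R) (M' : 'M[H]_(p, m)) :
  M *m (a%:A *: M') = a%:A *: (M *m M').
Proof. by rewrite -mul_scalar_mx mulmxA mulmx_real scalemxAl. Qed.

Lemma real_series_star n m p (f : qseries t n m) k :
  (real_series n p ⋆ f) k = \sum_(j < k.+1) (p`_j)%:A *: f (k - j)%N.
Proof. by rewrite star_rev; apply: eq_bigr => j _; rewrite mul_scalar_mx. Qed.

Lemma real_series_starC n m p (f : qseries t n m) :
  f ⋆ real_series m p = real_series n p ⋆ f.
Proof.
apply/funext => k; rewrite real_series_star starE.
by apply: eq_bigr => j _; rewrite mulmx_real.
Qed.

Lemma real_series_polynomial n p : ps_polynomial (real_series n p).
Proof.
exists (size p) => // k /= pk.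
by rewrite /real_series nth_default // scale0r raddf0.
Qed.

Lemma real_series_invertible n (p : {poly R}) : p`_0 = 1 ->
  mx_invertible (real_series n p 0%N).
Proof. by move=> p0; exists 1%:M; rewrite /real_series p0 scale1r mul1mx. Qed.

Definition has_real_denominator n m (f : qseries t n m) : Prop :=
  exists2 p : {poly R}, p`_0 = 1 & ps_polynomial (real_series n p ⋆ f).

Lemma has_real_denominator_realizable n m (f : qseries t n m) :
  has_real_denominator f -> is_realizable f.
Proof.
move=> [p p0]; apply: left_quotient_realizable.
  exact: real_series_polynomial.
exact: real_series_invertible.
Qed.

(* The denominator is the reciprocal polynomial of [chi]. *)
Lemma shift_annihilator_denominator n m (f : qseries t n m)
    (chi : {poly R}) k0 :
  chi \is monic ->
  (forall k, (k0 <= k)%N ->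
    \sum_(i < size chi) (chi`_i)%:A *: f (k + i)%N = 0) ->
  has_real_denominator f.
Proof.
move=> chi_monic chi0; set d := (size chi).-1.
have sd : size chi = d.+1 by rewrite prednK // size_poly_gt0 monic_neq0.
exists (\poly_(i < d.+1) chi`_(d - i)).
  by rewrite coef_poly /= subn0 -(monicP chi_monic) lead_coefE.
exists (k0 + d)%N => // k /= kd.
rewrite real_series_star -(subnK (_ : d <= k)%N); last by lia.
set k' := (k - d)%N.
rewrite -addnS addnC big_split_ord /= addrC big1 ?add0r => [|j _].
  rewrite -[RHS](chi0 k'); last by lia.
  rewrite sd (reindex_inj rev_ord_inj) /=; apply: eq_bigr => j _.
  have := ltn_ord j; rewrite coef_poly => jd.
  by rewrite ifT; [congr ((chi`_ _)%:A *: f _); lia|lia].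
by rewrite coef_poly ifF ?scale0r //; lia.
Qed.

(** Left multiplication by [A] is a real-linear map on a finitely spanned space, so a monic real
    [chi] has [chi(A) = 0]. Multiplying this by [C *m A ^+ k.-1] on the left and by [B] on the right
    gives a recurrence for [f], valid from [k = 1] on. *)
Lemma realizable_has_real_denominator n m (f : qseries t n m) :
  is_realizable f -> has_real_denominator f.
Proof.
move=> [N [A [B [C fE]]]]; have [d [e eP]] := matrix_real_span t N N.
have [|i|chi chi_monic chi0] := @real_linear_annihilator _ _ _ (mulmx A) d e.
- by move=> a u v; rewrite mulmxDr mulmx_real_scale.
- exact: eP.
apply: (shift_annihilator_denominator (k0 := 1) chi_monic) => k k1.
have iterA i : iter i (mulmx A) 1%:M = A ^+ i.
  by elim: i => //= i ->; rewrite exprS.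
have := congr1 (fun X => C *m (A ^+ k.-1 *m X) *m B) (chi0 1%:M (eP _)).
rewrite /= !mulmx0 mul0mx => chi1; rewrite -[RHS]chi1 !mulmx_sumr mulmx_suml.
apply: eq_bigr => i _; rewrite iterA fE; last by lia.
rewrite !mulmx_real_scale -scalemxAl; congr (_ *: (_ *m _ *m _)).
by rewrite -[RHS]/(A ^+ k.-1 * A ^+ i) -exprD; congr (A ^+ _); lia.
Qed.

End Realization.

(** * Real denominators, shift spaces and polynomial quotients *)

Section Equivalences.
Variables (R : realType) (t : R).
Local Notation H := (squat t).

(** The leading variable delays the geometric series of [A] by one index; this links the closed
    formula of (1) to the coefficients in (2). *)
Lemma transfer_seriesE N n m (A : 'M[H]_N) (B : 'M[H]_(N, m))
    (C : 'M[H]_(n, N)) k :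
  (ps_var t n ⋆ ps_const C
     ⋆ star_inv (ps_const 1%:M - ps_var t N ⋆ ps_const A) ⋆ ps_const B) k =
  if k is j.+1 then C *m A ^+ j *m B else 0.
Proof.
rewrite star_inv_geometric star_ps_const -starA ps_var_star.
by case: k => [|k]; rewrite ?mul0mx // ps_const_star.
Qed.

Lemma iter_backward_shift n m (f : qseries t n m) i k :
  iter i (@backward_shift R t n m) f k = f (k + i)%N.
Proof.
by elim: i k => [|i IH] k; rewrite ?addn0 //= /backward_shift IH addnS.
Qed.

Lemma finite_dim_has_real_denominator n m (f : qseries t n m) :
  real_finite_dim (shift_space f) -> has_real_denominator f.
Proof.
move=> [d [e [We spanW]]].
have shiftL (a : R) (u v : nat -> 'cV[H]_n) :
    backward_shift (a%:A *: u + v) =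
    a%:A *: backward_shift u + backward_shift v by [].
have [//|i|chi chi_monic chi0] :=
  @real_linear_annihilator _ _ _ (@backward_shift R t n 1) d e.
  (* The shift space is invariant: shifting a generator [R_0^k f b] only raises [k]. *)
  have [d' [c [g [gS ->]]]] := We i; apply: spanW.
  rewrite (_ : backward_shift _ = \sum_j (c j)%:A *: backward_shift (g j)).
    apply: real_span_sum => j; apply/real_spanZ/real_span_gen.
    by have [k [b ->]] := gS j; exists k.+1, b.
  by apply/funext => k; rewrite /backward_shift !fct_sumE.
apply: (shift_annihilator_denominator (k0 := 0) chi_monic) => k _.
apply/matrixP => i j.
suff /matrixP/(_ i 0) :
    col j (\sum_(l < size chi) (chi`_l)%:A *: f (k + l)%N) = 0.
  by rewrite !mxE.
(* Column [j] of [f] is [f] times a unit vector, an element of the shift space, so [chi] annihilates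
   [f] column by column. *)
have : shift_space f (ps_mulr f (delta_mx j 0)).
  by apply: real_span_gen; exists 0%N, (delta_mx j 0).
move=> /spanW/chi0/(congr1 (fun g => g k)).
rewrite fct_sumE colE mulmx_suml => H0.
rewrite -[RHS]H0; apply: eq_bigr => l _.
by rewrite fctE iter_backward_shift -scalemxAl.
Qed.

(** As [p(0) = 1], a vanishing coefficient [j + k] of [p ⋆ f] expresses [f (j + k)] by earlier
    values with weights independent of [j]. For [k >= L'] this holds for all [j], so the [k]-th
    shift is a real combination of earlier shifts. *)
Lemma shift_span_finite n m (f : qseries t n m) : has_real_denominator f ->
  exists L : nat, forall k,
    real_span (range (fun i : 'I_L => iter i (@backward_shift R t n m) f))
      (iter k (@backward_shift R t n m) f).
Proof.
move=> [p p0 /ps_polynomial_bound[L pf0]]; pose L' := maxn L (size p).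
exists L'; elim/ltn_ind => k IH; have [kL|Lk] := ltnP k L'.
  by apply: real_span_gen; exists (Ordinal kL).
rewrite (_ : iter k _ _ = \sum_(i < L') (- p`_i.+1)%:A *:
    iter (k - i.+1) (@backward_shift R t n m) f).
  by apply: real_span_sum => i; apply/real_spanZ/IH; have := ltn_ord i; lia.
apply/funext => j; rewrite fct_sumE iter_backward_shift.
(* The index is [j + k], written so that the sum splits after the [L'] terms that can be nonzero
   besides the leading one. *)
have : (real_series t n p ⋆ f) (L' + (j + k - L'))%N = 0 by rewrite pf0 //; lia.
rewrite real_series_star big_ord_recl p0 !scale1r subn0 => /eqP.
set r := (j + k - L')%N; have jkE : (j + k)%N = (L' + r)%N by rewrite /r; lia.
rewrite jkE addr_eq0 => /eqP ->.
rewrite big_split_ord /= [X in _ + X]big1 ?addr0 => [|i _].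
  rewrite -sumrN; apply: eq_bigr => i _; rewrite fctE iter_backward_shift.
  rewrite !scaleNr.
  by rewrite addnBA ?jkE //; have := ltn_ord i; lia.
rewrite nth_default ?scale0r // /bump leq0n add1n.
by rewrite ltnW // ltnS (leq_trans _ (leq_addr _ _)) // leq_maxr.
Qed.

(** Finitely many shifts of [f] times finitely many columns spanning the vectors [b] suffice,
    because real coefficients of [b] can be moved to the left of [f]. *)
Lemma has_real_denominator_finite_dim n m (f : qseries t n m) :
  has_real_denominator f -> real_finite_dim (shift_space f).
Proof.
move=> /shift_span_finite[L spanL]; have [d [u spanu]] := matrix_real_span t m 1.
pose T : finType := ('I_L * 'I_d)%type.
pose e (x : T) : nat -> 'cV[H]_n :=
  ps_mulr (iter x.1 (@backward_shift R t n m) f) (u x.2).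
exists #|{: T}|, (fun i => e (enum_val i)); split.
  move=> i; apply: real_span_gen.
  by exists (enum_val i : T).1, (u (enum_val i : T).2).
apply: real_span_sub => g [k [b ->]].
have [c ->] := real_span_range (spanL k).
have [c' ->] := real_span_range (spanu b).
rewrite (_ : ps_mulr _ _ = \sum_i (c i)%:A *: \sum_j (c' j)%:A *: e (i, j)).
  apply: real_span_sum => i; apply/real_spanZ/real_span_sum => j.
  apply/real_spanZ/real_span_gen.
  by exists (enum_rank ((i, j) : T)) => //=; rewrite enum_rankK.
apply/funext => l; rewrite /ps_mulr !fct_sumE mulmx_suml; apply: eq_bigr => i _.
rewrite !fctE -scalemxAl mulmx_sumr; congr (_ *: _).
by rewrite fct_sumE; apply: eq_bigr => j _; rewrite mulmx_real_scale.
Qed.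

Lemma has_real_denominator_quotient n m (f : qseries t n m) :
  has_real_denominator f ->
  exists (P1 P4 : qseries t n m) (P2 : qseries t m m) (P3 : qseries t n n),
    [/\ [/\ ps_polynomial P1, ps_polynomial P2, ps_polynomial P3
          & ps_polynomial P4],
        mx_invertible (P2 0%N), mx_invertible (P3 0%N),
        f = P1 ⋆ star_inv P2 & f = star_inv P3 ⋆ P4].
Proof.
move=> [p p0 pf]; pose Q := real_series t n p ⋆ f.
have inv l := real_series_invertible t l p0.
have poly l := real_series_polynomial t l p.
exists Q, Q, (real_series t m p), (real_series t n p); split=> //.
- have [T [pT Tp]] := star_inverse_ex (inv m).
  by rewrite (star_invE pT Tp) /Q -real_series_starC -starA pT star1r.
- have [T [pT Tp]] := star_inverse_ex (inv n).
  by rewrite (star_invE pT Tp) /Q starA Tp star1l.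
Qed.

Lemma quotient_realizable n m (f P4 : qseries t n m) (P3 : qseries t n n) :
  ps_polynomial P3 -> ps_polynomial P4 -> mx_invertible (P3 0%N) ->
  f = star_inv P3 ⋆ P4 -> is_realizable f.
Proof.
move=> polyP3 polyP4 invP3 fE; apply: (left_quotient_realizable polyP3 invP3).
have [T [PT TP]] := star_inverse_ex invP3.
by rewrite fE (star_invE PT TP) starA PT star1l.
Qed.

End Equivalences.

(** * Real power series *)

Section RealPowerSeries.
Variable R : realType.

Lemma pseries_recl (g : nat -> R) (x : R) N :
  pseries g x N.+1 = g 0%N + x * pseries (fun k => g k.+1) x N.
Proof.
rewrite /pseries /series /= !big_mkord big_ord_recl expr0 mulr1 mulr_sumr.
by congr (_ + _); apply: eq_bigr => k _; rewrite exprS mulrCA.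
Qed.

(** The terms at a fixed point [y] are bounded by some [M]. At the smaller point [y * rho] the
    non-constant terms sum to at most half of [|g 0|], so if [g 0] were nonzero the partial sums
    could not tend to [0]. *)
Lemma pseries_zero_constant_term (g : nat -> R) (e : R) : 0 < e ->
  (forall x, 0 < x < e -> pseries g x @ \oo --> 0) -> g 0%N = 0.
Proof.
move=> e0 g0; have [//|gn0] := eqVneq (g 0%N) 0; exfalso.
pose y := e / 2; have y0 : 0 < y by rewrite divr_gt0.
have ye : 0 < y < e by rewrite y0 /y; lra.
have [M M0 gM] : exists2 M, 0 < M & forall k, `|g k * y ^+ k| <= M.
  have /cvg_series_bounded/ex_strict_bound_gt0[M M0 gM] : cvgn (pseries g y).
    by apply/cvg_ex; exists 0; exact: g0.
  by exists M => // k; apply: ltW; exact: gM.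
have ng0 : 0 < `|g 0%N| by rewrite normr_gt0.
have gM0 : `|g 0%N| <= M by have := gM 0%N; rewrite expr0 mulr1.
(* With this choice [M * rho = |g 0| / 4] and [rho <= 1 / 4], hence
   [M * rho / (1 - rho) <= |g 0| / 2]. *)
pose rho := `|g 0%N| / (4 * M).
have rhoM : rho * (4 * M) = `|g 0%N| by rewrite divfK // gt_eqF //; lra.
have rho0 : 0 < rho by rewrite divr_gt0 //; lra.
have rho4 : rho <= 1 / 4 by nra.
have tail N :
    `|y * rho * pseries (fun k => g k.+1) (y * rho) N| <= `|g 0%N| / 2.
  have -> : y * rho * pseries (fun k => g k.+1) (y * rho) N =
      \sum_(k < N) (g k.+1 * y ^+ k.+1) * rho ^+ k.+1.
    rewrite /pseries /series /= big_mkord mulr_sumr; apply: eq_bigr => k _.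
    by rewrite mulrCA -exprS exprMn mulrA.
  apply: le_trans (ler_norm_sum _ _ _) _.
  apply: (@le_trans _ _ (\sum_(k < N) (M * rho) * rho ^+ k)).
    apply: ler_sum => k _.
    rewrite normrM [`|rho ^+ _|]ger0_norm ?exprn_ge0 ?(ltW rho0) //.
    by rewrite -mulrA -exprS ler_wpM2r ?exprn_ge0 ?(ltW rho0).
  have := @geometric_le_lim R N (M * rho) rho.
  rewrite /series /= big_mkord => H; apply: le_trans (H _ rho0 _) _; rewrite {H}.
  - by apply: mulr_ge0; exact: ltW.
  - by rewrite gtr0_norm //; lra.
  - rewrite ler_pdivrMr; last by lra.
    nra.
have /cvgrPdist_lt/(_ (`|g 0%N| / 2)) : pseries g (y * rho) @ \oo --> 0.
  by apply: g0; rewrite mulr_gt0 //=; nra.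
rewrite divr_gt0 // => /(_ isT)[N _ /(_ N.+1 (leqnSn N))] /=.
rewrite sub0r normrN pseries_recl; have := tail N.
set z := y * rho * _ => zle; have := ler_normB (g 0%N + z) z.
by rewrite addrK; lra.
Qed.

(** The identity theorem, by induction on [k]: once the constant term is known to vanish, division
    by [x] passes to the shifted series. Working with [0 < x < e] makes this division legitimate. *)
Lemma pseries_zero (g : nat -> R) :
  (\forall x \near (0 : R), pseries g x @ \oo --> 0) -> forall k, g k = 0.
Proof.
move=> /nbhs_ballP[e /= e0 ge].
have {ge} : forall x, 0 < x < e -> pseries g x @ \oo --> 0.
  by move=> x /andP[x0 xe]; apply: ge; rewrite /ball /= sub0r normrN gtr0_norm.
move=> ge k; elim: k g ge => [|k IH] g ge.
  exact: (pseries_zero_constant_term e0 ge).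
apply: (IH (fun k => g k.+1)) => x /[dup] /ge gx /andP[x0 _].
have xn0 : x != 0 by rewrite gt_eqF.
rewrite (_ : pseries _ x = fun N => x^-1 * pseries g x N.+1).
  have : (fun N => x^-1 * pseries g x N.+1) @ \oo --> x^-1 * 0.
    by apply: cvgM; [exact: cvg_cst|rewrite cvg_shiftS].
  by rewrite mulr0.
apply/funext => N; rewrite pseries_recl (pseries_zero_constant_term e0 ge) add0r.
by rewrite mulKf.
Qed.

(** The Cauchy product determines [g k.+1] from earlier values with weights of absolute value [F j];
    geometric growth gives the inverse series a positive radius of convergence. *)
Lemma cauchy_inverse_growth (q : {poly R}) (g : nat -> R) : q`_0 != 0 ->
  (forall k, \sum_(j < k.+1) q`_j * g (k - j)%N = (k == 0%N)%:R) ->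
  exists2 M, 0 < M & forall k, `|g k| <= `|g 0%N| * M ^+ k.
Proof.
move=> q0 qg; pose F j := `|q`_j.+1 / q`_0|.
have F0 j : 0 <= F j by exact: normr_ge0.
(* The summand [1] ensures [M >= 1], so that [M ^+ (k - j) <= M ^+ k]; the rest bounds every partial
   sum of the weights. *)
pose M := 1 + \sum_(0 <= j < size q) F j.
have S0 : 0 <= \sum_(0 <= j < size q) F j by exact: sumr_ge0.
have FM n : \sum_(0 <= j < n) F j <= M.
  apply: (@le_trans _ _ (\sum_(0 <= j < size q) F j)); last by rewrite lerDr.
  have [nq|/ltnW qn] := leqP n (size q).
    by rewrite [leRHS](big_cat_nat (n := n)) //= lerDl sumr_ge0.
  rewrite (big_cat_nat (n := size q)) //=.
  suff -> : \sum_(size q <= j < n) F j = 0 by rewrite addr0.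
  rewrite big_nat big1 // => j /andP[jq _].
  by rewrite /F nth_default ?mul0r ?normr0 // ltnW.
have M1 : 1 <= M by rewrite lerDl.
exists M; first exact: lt_le_trans M1.
elim/ltn_ind => -[|k] IH; first by rewrite expr0 mulr1.
have := qg k.+1; rewrite big_ord_recl /= subn0 => /eqP.
rewrite addr_eq0 => /eqP qgE.
have -> : g k.+1 = - \sum_(j < k.+1) q`_j.+1 / q`_0 * g (k - j)%N.
  apply: (mulfI q0); rewrite qgE mulrN mulr_sumr; congr (- _).
  by apply: eq_bigr => j _; rewrite mulrA [q`_0 * _]mulrC divfK // lift0 subSS.
rewrite normrN; apply: le_trans (ler_norm_sum _ _ _) _.
apply: (@le_trans _ _ (\sum_(j < k.+1) F j * (`|g 0%N| * M ^+ k))).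
  apply: ler_sum => j _; rewrite normrM ler_wpM2l //.
  apply: le_trans (IH _ _) _; first by lia.
  by rewrite ler_wpM2l // ler_weXn2l // leq_subr.
rewrite -mulr_suml exprS [leRHS]mulrCA ler_wpM2r //.
  by rewrite mulr_ge0 ?exprn_ge0 // (le_trans _ M1).
by have := FM k.+1; rewrite big_mkord.
Qed.

Lemma pseries_growth_cvg (g : nat -> R) (c M : R) : 0 < M ->
  (forall k, `|g k| <= c * M ^+ k) ->
  \forall h \near (0 : R), cvgn (pseries g h).
Proof.
move=> M0 gM; near=> h; apply: normed_cvg.
have c0 : 0 <= c by have := gM 0%N; rewrite expr0 mulr1; exact: le_trans.
have hM : `|M * `|h| | < 1.
  rewrite ger0_norm ?mulr_ge0 ?(ltW M0) // -ltr_pdivlMl // mulr1.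
  near: h; apply/nbhs_ballP; exists M^-1 => /=; first by rewrite invr_gt0.
  by move=> h; rewrite /ball /= sub0r normrN.
apply: (series_le_cvg _ _ _ (is_cvg_geometric_series (a := c) hM)) => k /=.
- exact: normr_ge0.
- by rewrite !mulr_ge0 ?exprn_ge0 // mulr_ge0 // ltW.
- by rewrite normrM normrX exprMn mulrA ler_wpM2r // exprn_ge0.
Unshelve. all: by end_near. Qed.

End RealPowerSeries.

(** * Convergence along the real line *)

Section Convergence.
Variables (R : realType) (t : R).
Local Notation H := (squat t).
Local Open Scope complex_scope.

Lemma mx_cvgP (T : Type) (F : set_system T) (FF : Filter F) (U : topologicalType)
    n m (u : T -> 'M[U]_(n, m)) (M : 'M[U]_(n, m)) :
  u @ F --> M <-> forall i j, (fun x => u x i j) @ F --> M i j.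
Proof.
split=> [uM i j A MA|uM A [P MP PA]].
  apply: (uM [set N : 'M[U]_(n, m) | A (N i j)]).
  (* This product neighbourhood constrains only the entry [(i, j)]. *)
  exists (fun i' j' => [set y | (i' = i /\ j' = j) -> A y]) => [i' j'|N];
    last exact.
  have [[-> ->]|ij] := pselect (i' = i /\ j' = j).
    by apply: filterS MA => y Ay _.
  by apply: filterS filterT => y _ /ij.
have : \forall x \near F, forall ij : 'I_n * 'I_m, P ij.1 ij.2 (u x ij.1 ij.2).
  by apply: filter_forall => ij; apply: uM.
by apply: filterS => x Px; apply: PA => i j; exact: (Px (i, j)).
Qed.

Lemma normc_leD (z : R[i]) :
  (`|complex.Re z|%:C <= `|z|) * (`|complex.Im z|%:C <= `|z|) *
  (`|z| <= (`|complex.Re z| + `|complex.Im z|)%:C).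
Proof.
case: z => a b /=; rewrite normc_def /= !lecR; split; first split.
- by rewrite -sqrtr_sqr ler_wsqrtr //; nra.
- by rewrite -sqrtr_sqr ler_wsqrtr //; nra.
- rewrite -[leRHS]ger0_norm ?addr_ge0 // -sqrtr_sqr ler_wsqrtr //.
  have := normr_ge0 a; have := normr_ge0 b.
  by rewrite -(real_normK (num_real a)) -(real_normK (num_real b)); nra.
Qed.

Lemma complex_cvgP (T : Type) (F : set_system T) (FF : Filter F)
    (u : T -> R[i]^o) (z : R[i]^o) :
  u @ F --> z <->
  (fun x => complex.Re (u x)) @ F --> complex.Re z /\
  (fun x => complex.Im (u x)) @ F --> complex.Im z.
Proof.
split=> [/cvgrPdist_lt uz|[/cvgrPdist_lt ru /cvgrPdist_lt iu]].
  split; apply/cvgrPdist_lt => e e0; have := uz e%:C; rewrite ltcR => /(_ e0);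
    apply: filterS => x; rewrite -ltcR; apply: le_lt_trans.
    by rewrite -raddfB; exact: (normc_leD (z - u x)).1.1.
  by rewrite -raddfB; exact: (normc_leD (z - u x)).1.2.
(* A positive element of [R[i]] is real, so the imaginary part of the radius is zero. *)
apply/cvgrPdist_lt => -[e e']; rewrite ltcE /= => /andP[/eqP -> e0].
have e2 : 0 < e / 2 by rewrite divr_gt0.
near=> x; apply: (le_lt_trans (normc_leD _).2); rewrite complexr0 ltcR.
rewrite !raddfB /= [e]splitr; apply: ltrD; near: x; [exact: ru|exact: iu].
Unshelve. all: by end_near. Qed.

(** Convergence for the induced topology is entrywise, and the second column depends on the first by
    conjugation and multiplication by [t], both continuous. *)
Lemma squat_cvgP (T : Type) (F : set_system T) (FF : Filter F)
    (u : T -> H) (q : H) :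
  u @ F --> q <->
  forall l, (fun x => squat_coord (u x) l) @ F --> squat_coord q l.
Proof.
have entries : u @ F --> q <->
    (fun x => squat_mx (u x) : 'M[R[i]^o]_2) @ F --> (squat_mx q : 'M[R[i]^o]_2).
  split=> [uq|uq].
    by move=> A /(@initial_continuous H _ (@squat_mx R t : H -> 'M[R[i]^o]_2) q)/uq.
  move=> A [_ [[B Bop <-] Bq BA]].
  by apply: (filterS BA); apply: uq; apply: open_nbhs_nbhs.
apply: (iff_trans entries); apply: (iff_trans (mx_cvgP _ _ _)); split.
  move=> uq l; have /complex_cvgP[r0 i0] := uq 0 0.
  have /complex_cvgP[r1 i1] := uq 1 0.
  by case: l => [[|[|[|[|//]]]] ?]; rewrite /squat_coord /=.
move=> uq i j.
have r0 := uq (@Ordinal 4 0 isT); have i0 := uq (@Ordinal 4 1 isT).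
have r1 := uq (@Ordinal 4 2 isT); have i1 := uq (@Ordinal 4 3 isT).
rewrite /squat_coord /= in r0 i0 r1 i1.
have e01 (p : H) : squat_mx p 0 1 = t%:C * conjc (squat_mx p 1 0).
  by have [a [b ->]] := squat_mk p; rewrite !mxE /= conjcK.
have e11 (p : H) : squat_mx p 1 1 = conjc (squat_mx p 0 0).
  by have [a [b ->]] := squat_mk p; rewrite !mxE /=.
have r01 (p : H) : complex.Re (squat_mx p 0 1) = t * complex.Re (squat_mx p 1 0).
  by rewrite e01; case: (squat_mx p 1 0) => a b /=; ring.
have i01 (p : H) : complex.Im (squat_mx p 0 1) = - t * complex.Im (squat_mx p 1 0).
  by rewrite e01; case: (squat_mx p 1 0) => a b /=; ring.
have r11 (p : H) : complex.Re (squat_mx p 1 1) = complex.Re (squat_mx p 0 0).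
  by rewrite e11; case: (squat_mx p 0 0).
have i11 (p : H) : complex.Im (squat_mx p 1 1) = - complex.Im (squat_mx p 0 0).
  by rewrite e11; case: (squat_mx p 0 0).
have ord2 (k : 'I_2) : k = 0 \/ k = 1.
  by case: k => [[|[|//]] ?]; [left|right]; exact/val_inj.
apply/complex_cvgP; case: (ord2 i) => ->; case: (ord2 j) => -> //.
- rewrite r01 i01; under eq_cvg do rewrite r01.
  under [X in _ /\ X]eq_cvg do rewrite i01.
  by split; apply: cvgM => //; exact: cvg_cst.
- rewrite r11 i11; under eq_cvg do rewrite r11.
  under [X in _ /\ X]eq_cvg do rewrite i11.
  by split => //; exact: cvgN.
Qed.

End Convergence.

(** * Evaluation of power series at real points *)

Section SeriesConvergence.
Variables (R : realType) (t : R).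
Local Notation H := (squat t).

Lemma squat_coordD (p q : H) l :
  squat_coord (p + q) l = squat_coord p l + squat_coord q l.
Proof.
have mxE2 i j : squat_mx (p + q) i j = squat_mx p i j + squat_mx q i j.
  by rewrite mxE.
by case: l => [[|[|[|[|//]]]] ?]; rewrite /squat_coord /= mxE2 raddfD.
Qed.

Lemma squat_coordZ (a : R) (q : H) l :
  squat_coord (a%:A * q) l = a * squat_coord q l.
Proof.
have mxE2 i j : squat_mx (a%:A * q) i j = (a%:C)%C * squat_mx q i j.
  by rewrite mulr_algl mxE.
by case: l => [[|[|[|[|//]]]] ?]; rewrite /squat_coord /= mxE2;
  case: (squat_mx q _ _) => x y /=; ring.
Qed.

Lemma squat_coord0 l : squat_coord (0 : H) l = 0.
Proof. by rewrite -[0](mul0r 0) -[X in X * _](scale0r 1) squat_coordZ mul0r. Qed.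

Lemma squat_coord_sum I (r : seq I) (F : I -> H) l :
  squat_coord (\sum_(i <- r) F i) l = \sum_(i <- r) squat_coord (F i) l.
Proof.
by elim/big_rec2: _ => [|i x y _ <-]; rewrite ?squat_coord0 ?squat_coordD.
Qed.

Lemma squat_coord_inj (p q : H) : squat_coord p =1 squat_coord q -> p = q.
Proof.
move=> pq; rewrite [p]squat_basisE [q]squat_basisE.
by apply: eq_bigr => l _; rewrite pq.
Qed.

(** Each coordinate of the product is a real-linear form in the coordinates of the right factor;
    this gives the continuity of multiplication by a constant matrix. *)
Lemma squat_coord_mulmx n p m (M : 'M[H]_(n, p)) (L : 'M[H]_(p, m)) i j l :
  squat_coord ((M *m L) i j) l =
  \sum_k \sum_a squat_coord (L k j) a * squat_coord (M i k * squat_basis t a) l.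
Proof.
rewrite mxE squat_coord_sum; apply: eq_bigr => k _.
rewrite {1}[L k j]squat_basisE mulr_sumr squat_coord_sum; apply: eq_bigr => a _.
by rewrite -squat_coordZ [in RHS]mulr_algl scalerAl mulrA mulr_algr.
Qed.

Lemma mx_coord_cvgP (T : Type) (F : set_system T) (FF : Filter F) n m
    (u : T -> 'M[H]_(n, m)) (L : 'M[H]_(n, m)) :
  u @ F --> L <->
  forall i j l, (fun x => squat_coord (u x i j) l) @ F --> squat_coord (L i j) l.
Proof.
apply: (iff_trans (mx_cvgP _ _ _)); split=> [uL i j l|uL i j].
  by have /squat_cvgP := uL i j; apply.
by apply/squat_cvgP.
Qed.

Lemma mx_cvg_unique n m (u : nat -> 'M[H]_(n, m)) (L L' : 'M[H]_(n, m)) :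
  u @ \oo --> L -> u @ \oo --> L' -> L = L'.
Proof.
move=> /mx_coord_cvgP uL /mx_coord_cvgP uL'; apply/matrixP => i j.
by apply: squat_coord_inj => l; exact: (cvg_unique _ (uL i j l) (uL' i j l)).
Qed.

Lemma mx_cvgD (T : Type) (F : set_system T) (FF : Filter F) n m
    (u v : T -> 'M[H]_(n, m)) (L L' : 'M[H]_(n, m)) :
  u @ F --> L -> v @ F --> L' -> (fun x => u x + v x) @ F --> L + L'.
Proof.
move=> /mx_coord_cvgP uL /mx_coord_cvgP vL'; apply/mx_coord_cvgP => i j l.
rewrite mxE squat_coordD; under eq_cvg do rewrite mxE squat_coordD.
exact: cvgD.
Qed.

Lemma cvg_bigsum (T : Type) (F : set_system T) (FF : Filter F) (I : Type)
    (r : seq I) (u : I -> T -> R) (c : I -> R) :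
  (forall i, u i @ F --> c i) ->
  (fun x => \sum_(i <- r) u i x) @ F --> \sum_(i <- r) c i.
Proof.
move=> uc; elim: r => [|i r IH].
  by rewrite big_nil; under eq_cvg do rewrite big_nil; exact: cvg_cst.
by rewrite big_cons; under eq_cvg do rewrite big_cons; exact: cvgD.
Qed.

Lemma mx_cvg_mulmx (T : Type) (F : set_system T) (FF : Filter F) n p m
    (M : 'M[H]_(n, p)) (u : T -> 'M[H]_(p, m)) (L : 'M[H]_(p, m)) :
  u @ F --> L -> (fun x => M *m u x) @ F --> M *m L.
Proof.
move=> /mx_coord_cvgP uL; apply/mx_coord_cvgP => i j l.
rewrite squat_coord_mulmx; under eq_cvg do rewrite squat_coord_mulmx.
apply: cvg_bigsum => k; apply: cvg_bigsum => a.
by apply: cvgM => //; exact: cvg_cst.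
Qed.

Lemma mx_cvg_scale (T : Type) (F : set_system T) (FF : Filter F) n m
    (a : R) (u : T -> 'M[H]_(n, m)) (L : 'M[H]_(n, m)) :
  u @ F --> L -> (fun x => a%:A *: u x) @ F --> a%:A *: L.
Proof.
move=> uL; rewrite -mul_scalar_mx; under eq_cvg do rewrite -mul_scalar_mx.
exact: mx_cvg_mulmx.
Qed.

Definition sums_to n m (f : qseries t n m) (x : R) (L : 'M[H]_(n, m)) : Prop :=
  ps_partial_sums f x%:A @ \oo --> L.

Lemma real_partial_sumsE n m (f : qseries t n m) (x : R) N :
  ps_partial_sums f x%:A N = \sum_(k < N) (x ^+ k)%:A *: f k.
Proof.
rewrite /ps_partial_sums /series /= big_mkord; apply: eq_bigr => k _.
by rewrite exprZn expr1n.
Qed.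

Lemma sums_to_coordP n m (f : qseries t n m) (x : R) (L : 'M[H]_(n, m)) :
  sums_to f x L <->
  forall i j l, pseries (fun k => squat_coord (f k i j) l) x @ \oo -->
    squat_coord (L i j) l.
Proof.
have coordE i j l N : squat_coord (ps_partial_sums f x%:A N i j) l =
    pseries (fun k => squat_coord (f k i j) l) x N.
  rewrite real_partial_sumsE /pseries /series /= big_mkord summxE squat_coord_sum.
  by apply: eq_bigr => k _; rewrite mxE squat_coordZ mulrC.
apply: (iff_trans (mx_coord_cvgP _ _ _)); split=> fL i j l.
  by under eq_cvg do rewrite -coordE; exact: fL.
by under eq_cvg do rewrite coordE; exact: fL.
Qed.

Lemma sums_to_unique n m (f : qseries t n m) (x : R) (L L' : 'M[H]_(n, m)) :
  sums_to f x L -> sums_to f x L' -> L = L'.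
Proof. exact: mx_cvg_unique. Qed.

Lemma sums_toD n m (f g : qseries t n m) (x : R) (L L' : 'M[H]_(n, m)) :
  sums_to f x L -> sums_to g x L' -> sums_to (f + g) x (L + L').
Proof.
move=> fL gL'; rewrite /sums_to.
under eq_cvg => N.
  rewrite (_ : ps_partial_sums (f + g) x%:A N =
    ps_partial_sums f x%:A N + ps_partial_sums g x%:A N); first over.
  rewrite !real_partial_sumsE -big_split; apply: eq_bigr => k _.
  by rewrite qseries_addE scalerDr.
exact: mx_cvgD.
Qed.

Lemma sums_to_const_star n p m (M : 'M[H]_(n, p)) (f : qseries t p m) (x : R) L :
  sums_to f x L -> sums_to (ps_const M ⋆ f) x (M *m L).
Proof.
move=> fL; rewrite /sums_to.
under eq_cvg => N.
  rewrite (_ : ps_partial_sums _ x%:A N = M *m ps_partial_sums f x%:A N);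
    first over.
  rewrite !real_partial_sumsE mulmx_sumr; apply: eq_bigr => k _.
  by rewrite ps_const_star mulmx_real_scale.
exact: mx_cvg_mulmx.
Qed.

Lemma sums_to_var_star n m (f : qseries t n m) (x : R) L :
  sums_to f x L -> sums_to (ps_var t n ⋆ f) x (x%:A *: L).
Proof.
move=> fL; rewrite /sums_to -cvg_shiftS /=.
under eq_cvg => N.
  rewrite (_ : ps_partial_sums _ x%:A N.+1 = x%:A *: ps_partial_sums f x%:A N);
    first over.
  rewrite !real_partial_sumsE big_ord_recl ps_var_star scaler0 add0r scaler_sumr.
  by apply: eq_bigr => k _; rewrite ps_var_star real_scaleA exprS.
exact: mx_cvg_scale.
Qed.

Lemma sums_to_const n m (M : 'M[H]_(n, m)) (x : R) : sums_to (ps_const M) x M.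
Proof.
rewrite /sums_to -cvg_shiftS /=; apply: cvg_near_cst; apply: nearW => N.
rewrite real_partial_sumsE big_ord_recl big1 ?addr0 ?scale1r // => k _.
by rewrite scaler0.
Qed.

(** Horner's decomposition, the step in inductions on the length of a polynomial. *)
Lemma qseries_recl n m (f : qseries t n m) :
  f = ps_const (f 0%N) + ps_var t n ⋆ backward_shift f.
Proof.
apply/funext => -[|k]; rewrite qseries_addE ps_var_star; first by rewrite addr0.
by rewrite add0r.
Qed.

Lemma ps_polynomial_sums_to n m (P : qseries t n m) (x : R) :
  ps_polynomial P -> exists L, sums_to P x L.
Proof.
move=> /ps_polynomial_bound[K]; elim: K P => [|K IH] P PK.
  exists 0; rewrite (_ : P = ps_const 0); first exact: sums_to_const.
  by apply/funext => k; rewrite PK // /ps_const /ps_monomial; case: ifP.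
have [|L PL] := IH (backward_shift P); first by move=> k Kk; exact: PK.
exists (P 0%N + x%:A *: L); rewrite [X in sums_to X]qseries_recl.
by apply: sums_toD; [exact: sums_to_const|exact: sums_to_var_star].
Qed.

(** Evaluation is multiplicative at real points, which commute with all coefficients. Since [P] is a
    polynomial, Horner's decomposition reduces the claim to constants and the variable, without
    rearranging a double series. *)
Lemma sums_to_star n p m (P : qseries t n p) (f : qseries t p m) (x : R) a b :
  ps_polynomial P -> sums_to P x a -> sums_to f x b -> sums_to (P ⋆ f) x (a *m b).
Proof.
move=> /ps_polynomial_bound[K PK] Pa fb; elim: K P PK a Pa => [|K IH] P PK a Pa.
  have P0 : P = ps_const 0.
    by apply/funext => k; rewrite PK // /ps_const /ps_monomial; case: ifP.
  rewrite P0 in Pa *; rewrite (sums_to_unique Pa (@sums_to_const _ _ 0 x)).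
  exact: sums_to_const_star.
have shiftP0 k : (K <= k)%N -> backward_shift P k = 0 by move=> Kk; exact: PK.
have [|a' Pa'] := @ps_polynomial_sums_to _ _ (backward_shift P) x.
  by exists K.
have aE : a = P 0%N + x%:A *: a'.
  apply: (sums_to_unique Pa); rewrite [X in sums_to X]qseries_recl.
  by apply: sums_toD; [exact: sums_to_const|exact: sums_to_var_star].
rewrite aE [X in sums_to (X ⋆ f)]qseries_recl starDl mulmxDl -starA -scalemxAl.
apply: sums_toD; first exact: sums_to_const_star.
by apply: sums_to_var_star; exact: IH.
Qed.

Lemma sums_to_real_series n (p : {poly R}) (x : R) :
  sums_to (real_series t n p) x (p.[x])%:A%:M.
Proof.
have [L pL] := ps_polynomial_sums_to x (real_series_polynomial t n p).
suff <- : L = (p.[x])%:A%:M by [].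
apply: (sums_to_unique pL); rewrite /sums_to; apply: cvg_near_cst.
exists (size p) => // N /= pN; rewrite real_partial_sumsE.
rewrite (horner_coef_wide _ pN) scaler_suml raddf_sum; apply: eq_bigr => k _.
rewrite /real_series -mul_scalar_mx -scalar_mxM; congr (_%:M).
by rewrite mulr_algl scalerA mulrC.
Qed.

Lemma sums_to_real_series_star n m (p : {poly R}) (f : qseries t n m) (x : R) L :
  sums_to f x L -> sums_to (real_series t n p ⋆ f) x ((p.[x])%:A *: L).
Proof.
move=> fL; rewrite -mul_scalar_mx; apply: sums_to_star => //.
  exact: real_series_polynomial.
exact: sums_to_real_series.
Qed.

Lemma sums_to_real_scalar n (g : nat -> R) (x c : R) :
  pseries g x @ \oo --> c ->
  sums_to (fun k => (g k)%:A%:M : 'M[H]_n) x c%:A%:M.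
Proof.
have entryE (a : R) i j l : squat_coord (((a%:A : H)%:M : 'M[H]_n) i j) l =
    a * squat_coord ((i == j)%:R : H) l.
  by rewrite mxE -squat_coordZ mulr_natr.
move=> gc; apply/sums_to_coordP => i j l; rewrite entryE.
rewrite (_ : pseries _ x =
    fun N => pseries g x N * squat_coord ((i == j)%:R : H) l).
  by apply: cvgM => //; exact: cvg_cst.
apply/funext => N; rewrite /pseries /series /= mulr_suml; apply: eq_bigr => k _.
by rewrite entryE mulrAC.
Qed.

End SeriesConvergence.

(** * Germs of rational functions *)

Section RationalGerms.
Variables (R : realType) (t : R).
Local Notation H := (squat t).

Lemma ps_polynomial_const n m (M : 'M[H]_(n, m)) : ps_polynomial (ps_const M).
Proof. by exists 1%N => // -[]. Qed.

Lemma ps_polynomialD n m (P Q : qseries t n m) :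
  ps_polynomial P -> ps_polynomial Q -> ps_polynomial (P + Q).
Proof.
move=> /ps_polynomial_bound[K1 PK] /ps_polynomial_bound[K2 QK].
by exists (maxn K1 K2) => // k /= kK; rewrite qseries_addE PK ?QK ?addr0 //; lia.
Qed.

Lemma ps_polynomial_star n p m (P : qseries t n p) (Q : qseries t p m) :
  ps_polynomial P -> ps_polynomial Q -> ps_polynomial (P ⋆ Q).
Proof.
move=> /ps_polynomial_bound[K1 PK] /ps_polynomial_bound[K2 QK].
exists (K1 + K2)%N => // k /= kK; rewrite starE big1 // => j _.
have [jK|jK] := leqP K2 j; first by rewrite QK // mulmx0.
by rewrite PK ?mul0mx //; lia.
Qed.

Lemma sums_to_zero n m (f : qseries t n m) :
  (\forall x \near (0 : R), sums_to f x 0) -> f = 0.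
Proof.
move=> f0; apply/funext => k; apply/matrixP => i j; apply: squat_coord_inj => l.
rewrite [in RHS]mxE squat_coord0.
apply: (pseries_zero (g := fun k => squat_coord (f k i j) l)).
by apply: filterS f0 => x /sums_to_coordP/(_ i j l); rewrite mxE squat_coord0.
Qed.

Lemma rational_real_denominator n m (r : R -> 'M[H]_(n, m)) : rational_near0 r ->
  exists (p : {poly R}) (Q : qseries t n m), [/\ p`_0 = 1, ps_polynomial Q &
    \forall x \near (0 : R), sums_to Q x (p.[x]%:A *: r x)].
Proof.
elim=> {n m r} [n m M||n m r s _ [p [P [p0 polyP Pr]]] _ [q [Q [q0 polyQ Qs]]]
  |n l m r s _ [p [P [p0 polyP Pr]]] _ [q [Q [q0 polyQ Qs]]]
  |n r s _ [p [P [p0 polyP Pr]]] inv_r _ rs].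
- exists 1, (ps_const M); split; [by rewrite coefC|exact: ps_polynomial_const|].
  by near=> x; rewrite hornerC !scale1r; exact: sums_to_const.
- exists 1, (real_series t 1 'X); split.
  + by rewrite coefC.
  + exact: real_series_polynomial.
  + near=> x; rewrite hornerC !scale1r -[in X in sums_to _ _ X](hornerX x).
    exact: sums_to_real_series.
- exists (p * q), (real_series t n q ⋆ P + real_series t n p ⋆ Q); split.
  + by rewrite coef0M p0 q0 mulr1.
  + by apply: ps_polynomialD; apply: ps_polynomial_star => //;
      exact: real_series_polynomial.
  + near=> x.
    have -> : (p * q).[x]%:A *: (r x + s x) =
        q.[x]%:A *: (p.[x]%:A *: r x) + p.[x]%:A *: (q.[x]%:A *: s x).
      by rewrite !real_scaleA scalerDr hornerM [q.[x] * _]mulrC.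
    by apply: sums_toD; apply: sums_to_real_series_star; near: x.
- exists (p * q), (P ⋆ Q); split.
  + by rewrite coef0M p0 q0 mulr1.
  + exact: ps_polynomial_star.
  + near=> x; rewrite hornerM -real_scaleA -mulmx_real_scale scalemxAl.
    by apply: sums_to_star => //; near: x.
- have p00 : p.[0] = 1 by rewrite horner_coef0.
  (* Evaluation at [x = 0], where [p] takes the value [1]. *)
  have P0 : P 0%N = r 0.
    apply: (@sums_to_unique _ _ _ _ P 0); last first.
      by have := nbhs_singleton Pr; rewrite p00 !scale1r.
    apply: cvg_near_cst; exists 1%N => // -[|N] //= _.
    rewrite real_partial_sumsE big_ord_recl big1 ?addr0 ?scale1r // => k _.
    by rewrite exprS mul0r !scale0r.
  rewrite -P0 in inv_r; have [T [PT TP]] := star_inverse_ex inv_r.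
  (* The formal inverse [T] is realizable because [P ⋆ T = 1] is a polynomial, so it has a real
     denominator [d]. *)
  have [|d d0 dT] := realizable_has_real_denominator (f := T).
    apply: left_quotient_realizable polyP inv_r _; rewrite PT.
    exact: ps_polynomial_const.
  exists d, (real_series t n p ⋆ (real_series t n d ⋆ T)); split=> //.
    by apply: ps_polynomial_star => //; exact: real_series_polynomial.
  (* Only the polynomials [d ⋆ T] and [P] are evaluated, never [T]. With [S] the value of [d ⋆ T],
     the identity [d = (d ⋆ T) ⋆ P] gives [d(x) = S p(x) r(x)], hence [d(x) s(x) = p(x) S]. *)
  near=> x; have [S dTS] := ps_polynomial_sums_to x dT.
  have Prx : sums_to P x (p.[x]%:A *: r x) by near: x.
  have [rsx srx] : r x *m s x = 1%:M /\ s x *m r x = 1%:M by near: x.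
  have : sums_to (real_series t n d ⋆ T ⋆ P) x (S *m (p.[x]%:A *: r x)).
    exact: sums_to_star.
  rewrite -starA TP star1r => /(sums_to_unique (@sums_to_real_series R t n d x)).
  move=> /(congr1 (fun M : 'M[H]_n => M *m s x)); rewrite mul_scalar_mx => ->.
  rewrite mulmx_real_scale -scalemxAl -mulmxA rsx mulmx1.
  exact: sums_to_real_series_star.
Unshelve. all: by end_near. Qed.

Lemma horner_near_neq0 (p : {poly R}) : p`_0 != 0 ->
  \forall x \near (0 : R), p.[x] != 0.
Proof.
rewrite -horner_coef0 => p0.
exact: (@cvgr_neq0 R R R (nbhs (0 : R)) _ (horner p) p.[0]
  (@continuous_horner R p 0) p0).
Qed.

(** Analyticity asks for an expansion around every [x] near [0]; it is the formal inverse of [p]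
    recentred at [x], convergent by [cauchy_inverse_growth]. *)
Lemma horner_inverse_analytic n (p : {poly R}) : p`_0 != 0 ->
  real_analytic_near0 (fun x : R => (p.[x]^-1)%:A%:M : 'M[H]_n).
Proof.
move=> p0; near=> x.
have px : p.[x] != 0.
  by near: x; exact: horner_near_neq0.
pose q := p \Po ('X + x%:P).
have qE h : q.[h] = p.[x + h] by rewrite horner_comp !hornerE addrC.
have q0 : q`_0 != 0 by rewrite -horner_coef0 qE addr0.
have [|T [qT _]] := @star_inverse_ex R t 1 (real_series t 1 q).
  exists ((q`_0)^-1)%:A%:M.
  by rewrite /real_series -!scalar_mxM !mulr_algl !scalerA mulfV // mulVf // scale1r.
have coord1 : squat_coord (1 : H) 0 = 1 by rewrite /squat_coord /= !mxE.
(* A coordinate of the ⋆-inverse over [H] is the inverse of [q] over [R]. *)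
pose g k := squat_coord (T k 0 0) 0.
have qg k : \sum_(j < k.+1) q`_j * g (k - j)%N = (k == 0%N)%:R.
  have := congr1 (fun f : nat -> 'M[H]_1 => squat_coord (f k 0 0) 0) qT.
  rewrite real_series_star summxE squat_coord_sum => qTk.
  transitivity (squat_coord (ps_const (1%:M : 'M[H]_1) k 0 0) 0).
    by rewrite -qTk; apply: eq_bigr => j _; rewrite mxE squat_coordZ.
  rewrite /ps_const /ps_monomial; case: eqP => _; first by rewrite mxE.
  by rewrite mxE squat_coord0.
have [M M0 gM] := cauchy_inverse_growth q0 qg.
exists (fun k => (g k)%:A%:M).
apply: filterS (pseries_growth_cvg M0 gM) => h /cvg_ex[c gc].
(* The sum [c] of the inverse series must be the inverse of [q.[h]]; evaluating the Cauchy product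
   of [q] and [g] at [h] shows this. *)
suff qhc : q.[h] * c = 1.
  suff -> : p.[x + h]^-1 = c by exact: sums_to_real_scalar.
  have qh : q.[h] != 0.
    by apply: contra_eq_neq qhc => ->; rewrite mul0r eq_sym oner_neq0.
  by apply: (mulfI qh); rewrite qhc qE mulfV // -qE.
have := @sums_to_real_series_star R t 1 1 q _ h _
  (@sums_to_real_scalar R t 1 g h c gc).
rewrite (_ : real_series t 1 q ⋆ _ = ps_const 1%:M); last first.
  apply/funext => k; rewrite real_series_star.
  transitivity (((k == 0%N)%:R : R)%:A%:M : 'M[H]_1).
    rewrite -qg scaler_suml raddf_sum; apply: eq_bigr => j _.
    by rewrite -mul_scalar_mx -scalar_mxM mulr_algl scalerA.
  by rewrite /ps_const /ps_monomial; case: eqP => _; rewrite ?scale1r ?scale0r ?raddf0.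
move=> /(sums_to_unique (@sums_to_const R t 1 1 1%:M h)).
move=> /(congr1 (fun A : 'M[H]_1 => squat_coord (A 0 0) 0)).
by rewrite !mxE !mulr1n squat_coordZ -[c%:A]mulr1 squat_coordZ coord1 mulr1 => <-.
Unshelve. all: by end_near. Qed.

Lemma rational_near0_eq n m (r s : R -> 'M[H]_(n, m)) :
  rational_near0 r -> r =1 s -> rational_near0 s.
Proof. by move=> rat_r /funext <-. Qed.

(** The variable is available only in size 1, so [x I_n] is assembled as the sum of the diagonal
    matrices [E i x], each a product of a unit column, the variable and a unit row. *)
Lemma rational_scale_var n m (r : R -> 'M[H]_(n, m)) :
  rational_near0 r -> rational_near0 (fun x : R => x%:A *: r x).
Proof.
move=> rat_r.
pose E (i : 'I_n) (x : R) : 'M[H]_n :=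
  delta_mx i (0 : 'I_1) *m (x%:A)%:M *m delta_mx (0 : 'I_1) i.
have ratE i : rational_near0 (E i).
  apply: rational_mul; last exact: rational_const.
  by apply: rational_mul; [exact: rational_const|exact: rational_var].
have sum_rational (s : seq 'I_n) : rational_near0 (fun x : R => \sum_(i <- s) E i x).
  elim: s => [|i s IH].
    by apply: rational_near0_eq (rational_const 0) _ => x; rewrite big_nil.
  by apply: rational_near0_eq (rational_add (ratE i) IH) _ => x; rewrite big_cons.
apply: rational_near0_eq
  (rational_mul (sum_rational (index_enum 'I_n)) rat_r) _ => x.
rewrite -mul_scalar_mx; congr (_ *m _); rewrite /E.
under eq_bigr do rewrite mulmx_real -scalemxAl mul_delta_mx.
by rewrite -scaler_sumr -mx1_sum_delta scalemx1.
Qed.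

Lemma rational_ps_eval n m (P : qseries t n m) K :
  rational_near0 (fun x : R => \sum_(k < K) (x ^+ k)%:A *: P k).
Proof.
elim: K P => [|K IH] P.
  by apply: rational_near0_eq (rational_const 0) _ => x; rewrite big_ord0.
apply: rational_near0_eq (rational_add (rational_const (P 0%N))
  (rational_scale_var (IH (backward_shift P)))) _ => x.
rewrite big_ord_recl !scale1r scaler_sumr; congr (_ + _).
by apply: eq_bigr => k _; rewrite real_scaleA -exprS.
Qed.

Lemma real_denominator_rational n m (f : qseries t n m) :
  ps_converges_near0 f -> has_real_denominator f ->
  exists r : R -> 'M[H]_(n, m), rational_near0 r /\
    \forall x \near (0 : R), sums_to f x (r x).
Proof.
move=> fcvg [p p0 polyQ]; pose Q := real_series t n p ⋆ f.
have [K QK] : exists K, forall k, (K <= k)%N -> Q k = 0.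
  exact: ps_polynomial_bound.
have sumsQ x : sums_to Q x (\sum_(k < K) (x ^+ k)%:A *: Q k).
  apply: cvg_near_cst; exists K => // N /= KN; rewrite real_partial_sumsE.
  rewrite -(subnKC KN) big_split_ord /= [X in _ + X]big1 ?addr0 // => k _.
  by rewrite QK ?scaler0 // leq_addr.
have pinv x : p.[x] != 0 -> (p.[x])^-1%:A * p.[x]%:A = 1 :> H.
  by move=> px; rewrite mulr_algl scalerA mulVf // scale1r.
have pnear : \forall x \near (0 : R), p.[x] != 0.
  by apply: horner_near_neq0; rewrite p0 oner_neq0.
(* The witness is [Q(x) / p(x)], with [Q] truncated at its length [K]. *)
exists (fun x => (p.[x]^-1)%:A%:M *m \sum_(k < K) (x ^+ k)%:A *: Q k); split.
  apply: rational_mul; last exact: rational_ps_eval.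
  apply: (@rational_inv _ _ _ (fun x => p.[x]%:A%:M)).
  - apply: rational_near0_eq (rational_ps_eval (real_series t n p) (size p)) _ => x.
    rewrite horner_coef scaler_suml raddf_sum.
    apply: eq_bigr => k _; rewrite /real_series -mul_scalar_mx -scalar_mxM.
    by congr (_%:M); rewrite mulr_algl scalerA mulrC.
  - by exists 1%:M; rewrite horner_coef0 p0 scale1r mul1mx.
  - by apply: horner_inverse_analytic; rewrite p0 oner_neq0.
  - apply: filterS pnear => x px.
    by rewrite -!scalar_mxM !mulr_algl !scalerA mulVf // mulfV // scale1r.
(* Continuity of [x] to [x%:A] pulls the convergence of [f] near [0] in H_t back to real points. *)
have real_cvg : (fun x : R => x%:A : H) @ (0 : R) --> (0 : H).
  apply/squat_cvgP => l; rewrite squat_coord0.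
  have : (fun x : R => x * squat_coord (1 : H) l) @ (0 : R) -->
      0 * squat_coord (1 : H) l.
    by apply: cvgM; [exact: cvg_id|exact: cvg_cst].
  rewrite mul0r; apply: cvg_trans; apply: near_eq_cvg; near=> x.
  by rewrite -squat_coordZ mulr1.
near=> x.
have /cvg_ex[L fL] : cvgn (ps_partial_sums f x%:A).
  by near: x; exact: (real_cvg _ fcvg).
have px : p.[x] != 0 by near: x.
rewrite mul_scalar_mx.
rewrite (sums_to_unique (sumsQ x) (@sums_to_real_series_star R t n m p f x L fL)).
by rewrite scalerA pinv // scale1r.
Unshelve. all: by end_near. Qed.

Lemma rational_sum_has_real_denominator n m (f : qseries t n m) r :
  rational_near0 r -> (\forall x \near (0 : R), sums_to f x (r x)) ->
  has_real_denominator f.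
Proof.
move=> /rational_real_denominator[p [Q [p0 polyQ Qr]]] fr; exists p => //.
(* The difference [p ⋆ f - Q] sums to [p(x) r(x) - p(x) r(x) = 0] near [0], so the identity theorem
   applies. It is written as a sum with a constant multiple to match the evaluation rules. *)
suff /eqP : real_series t n p ⋆ f + ps_const (- 1%:M) ⋆ Q = 0.
  rewrite addr_eq0 => /eqP ->.
  rewrite (_ : - _ = Q) //; apply/funext => k.
  by rewrite qseries_oppE ps_const_star mulNmx mul1mx opprK.
apply: sums_to_zero; near=> x.
have -> : 0 = p.[x]%:A *: r x + (- 1%:M) *m (p.[x]%:A *: r x).
  by rewrite mulNmx mul1mx subrr.
apply: sums_toD; first by apply: sums_to_real_series_star; near: x.
by apply: sums_to_const_star; near: x.
Unshelve. all: by end_near. Qed.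

End RationalGerms.

Theorem theorem7p3 (R : realType) (t : R) (ht : t != 0) (n m : nat)
    (f : qseries t n m) (hf : ps_converges_near0 f) :
  [<-> (* (1) *)
       exists (N : nat) (A : 'M[squat t]_N) (B : 'M[squat t]_(N, m))
              (C : 'M[squat t]_(n, N)),
         f = ps_const (f 0%N)
             + ps_var t n ⋆ ps_const C
               ⋆ star_inv (ps_const 1%:M - ps_var t N ⋆ ps_const A)
               ⋆ ps_const B;
       (* (2) *)
       exists (N : nat) (A : 'M[squat t]_N) (B : 'M[squat t]_(N, m))
              (C : 'M[squat t]_(n, N)),
         forall k : nat, (1 <= k)%N -> f k = C *m A ^+ k.-1 *m B;
       (* (3) *)
       real_finite_dim (shift_space f);
       (* (4) *)
       exists (P1 P4 : qseries t n m) (P2 : qseries t m m) (P3 : qseries t n n),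
         [/\ [/\ ps_polynomial P1, ps_polynomial P2, ps_polynomial P3
               & ps_polynomial P4],
             mx_invertible (P2 0%N), mx_invertible (P3 0%N),
             f = P1 ⋆ star_inv P2 & f = star_inv P3 ⋆ P4];
       (* (5) *)
       exists r : R -> 'M[squat t]_(n, m), rational_near0 r /\
         \forall x \near (0 : R), ps_partial_sums f x%:A @ \oo --> r x].
Proof.
tfae.
- move=> [N [A [B [C fE]]]]; exists N, A, B, C => -[//|k] _.
  by rewrite fE qseries_addE transfer_seriesE /ps_const /ps_monomial add0r.
- by move=> /realizable_has_real_denominator/has_real_denominator_finite_dim.
- by move=> /finite_dim_has_real_denominator/has_real_denominator_quotient.
- move=> [P1 [P4 [P2 [P3 [[_ _ polyP3 polyP4] _ invP3 _ fE]]]]].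
  apply: (real_denominator_rational hf); apply: realizable_has_real_denominator.
  exact: quotient_realizable polyP3 polyP4 invP3 fE.
- move=> [r [rat_r fr]].
  have := rational_sum_has_real_denominator rat_r fr.
  move=> /has_real_denominator_realizable[N [A [B [C fE]]]]; exists N, A, B, C.
  (* At index [0] the transfer term is zero and only [f 0%N] remains; at [k.+1] the constant term
     drops out. *)
  apply/funext => -[|k]; rewrite qseries_addE transfer_seriesE; first by rewrite addr0.
  by rewrite fE // /ps_const /ps_monomial add0r.
Qed.
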